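(* The determining number of the folded hypercube $FQ_n$ is $\det(FQ_n)=1$ if $n=1$; $3$ if $n=2$; $6$ if $n=3$; $\lceil \lg n\rceil+2$ if $n=2^m-1$ or $n=2^m-3$ for some integer $m\ge 3$; and $\lceil \lg(n+1)\rceil+1$ otherwise.
   Context: $\lg$ denotes $\log_2$. The folded hypercube $FQ_n$ has vertex set $\mathbb{Z}_2^n$ (binary strings of length $n$), two vertices being adjacent iff they differ in exactly one position or in all $n$ positions. A set $S$ of vertices is a determining set if the only automorphism of the graph fixing every vertex of $S$ is the identity; $\det$ is the minimum size of a determining set. *)

(* Defs.v *)
From HB Require Import structures.
From mathcomp Require Import all_boot all_order all_fingroup all_algebra.
Set Implicit Arguments.
Unset Strict Implicit.
Unset Printing Implicit Defensive.

Section GraphDetermining.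

Variables (T : finType) (e : rel T).

Definition automorphism (s : {perm T}) : bool :=
  [forall u, forall v, e (s u) (s v) == e u v].

Definition determining_set (S : {set T}) : bool :=
  [forall s : {perm T},
     automorphism s && [forall x in S, s x == x] ==> (s == 1%g)].

Lemma determining_setT : determining_set [set: T].
Proof.
apply/forallP=> s; apply/implyP=> /andP[_ /forallP fix_s].
apply/eqP/permP=> x; rewrite perm1; apply/eqP.
by have := fix_s x; rewrite in_setT.
Qed.

(* By determining_setT the default [set: T] satisfies the constraint, so the
   arg min is a genuine minimizer. *)
Definition determining_number : nat :=
  #|[arg min_(S < [set: T] | determining_set S) #|S|]|.

End GraphDetermining.

Definition hamming (n : nat) (u v : 'rV['Z_2]_n) : nat :=
  #|[set i : 'I_n | u ord0 i != v ord0 i]|.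

Definition folded_hypercube (n : nat) : rel 'rV['Z_2]_n :=
  fun u v => (hamming u v == 1) || (hamming u v == n).

Lemma folded_hypercube_sym n : symmetric (folded_hypercube (n := n)).
Proof.
move=> u v; rewrite /folded_hypercube.
suff -> : hamming u v = hamming v u by [].
by apply: eq_card => i; rewrite !inE eq_sym.
Qed.

(* Fails for n = 0, where "differ in all positions" holds vacuously. *)
Lemma folded_hypercube_irr n : 0 < n -> irreflexive (folded_hypercube (n := n)).
Proof.
move=> n_gt0 u; rewrite /folded_hypercube.
have -> : hamming u u = 0 by apply: eq_card0 => i; rewrite !inE eqxx.
by case: n n_gt0 u.
Qed.

(* Main.v *)
Require Import Defs.
From HB Require Import structures.
From mathcomp Require Import all_boot all_order all_fingroup all_algebra.
From mathcomp Require Import zify ring.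
Set Implicit Arguments.
Unset Strict Implicit.
Unset Printing Implicit Defensive.

(** Identify Z_2^n with the functions from n + 1 points to Z_2 modulo constants;
    then FQ_n is the Cayley graph whose generators are the n + 1 point
    indicators, and for n >= 4 the only 4-cycles are u, u + d_i, u + d_i + d_j,
    u + d_j. Hence every automorphism is a translation composed with a
    permutation of the n + 1 points. A vertex together with k others therefore
    determines the graph iff the induced map from the n + 1 points to Z_2^k is
    injective and its image is invariant under no nonzero translation. A subset
    of Z_2^k of size N >= 5 with this property exists iff N is odd and N <= 2^k,
    or N is even and N <= 2^k - 4: the complement of an invariance-free set has
    neither 0 nor 2 elements, and conversely an even N can be split along a
    hyperplane into two odd parts of different sizes. The graphs FQ_1 and FQ_2
    are complete and FQ_3 is K_{4,4}. *)

Import GRing.Theory.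
Local Open Scope ring_scope.

(** * Determining sets of finite graphs *)

Section DeterminingNumber.

Variables (T : finType) (e : rel T).

Lemma automorphismP (s : {perm T}) :
  reflect (forall u v, e (s u) (s v) = e u v) (automorphism e s).
Proof.
apply: (iffP forallP) => [h u v|h u]; first by have /forallP/(_ v)/eqP := h u.
by apply/forallP => v; rewrite h.
Qed.

Lemma determining_setP (S : {set T}) :
  reflect (forall s : {perm T}, (forall u v, e (s u) (s v) = e u v) ->
             (forall x, x \in S -> s x = x) -> s = 1%g)
          (determining_set e S).
Proof.
apply: (iffP forallP) => [h s es fs|h s].
  have /implyP hs := h s; apply/eqP/hs/andP; split; first exact/automorphismP.
  by apply/forall_inP => x /fs ->.
apply/implyP => /andP[/automorphismP es /forall_inP fs].
by apply/eqP/h => // x /fs /eqP.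
Qed.

Lemma determining_number_le (S : {set T}) :
  determining_set e S -> (determining_number e <= #|S|)%N.
Proof.
move=> dS; rewrite /determining_number.
by case: arg_minnP => [|A _ minA]; [exact: determining_setT | exact: minA].
Qed.

Lemma determining_numberP :
  exists2 S : {set T}, determining_set e S & #|S| = determining_number e.
Proof.
rewrite /determining_number; case: arg_minnP => [|A dA _].
  exact: determining_setT.
by exists A.
Qed.

Lemma determining_setS (A B : {set T}) :
  A \subset B -> determining_set e A -> determining_set e B.
Proof.
move=> /subsetP sAB /determining_setP dA; apply/determining_setP => s es fs.
by apply: dA => // x /sAB; apply: fs.
Qed.

(** The transposition of [a] and [b] is an automorphism that fixes [S] pointwise, hence trivial. *)
Lemma determining_set_twins (S : {set T}) (a b : T) :
  symmetric e -> irreflexive e -> determining_set e S ->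
  a \notin S -> b \notin S ->
  (forall w, w != a -> w != b -> e a w = e b w) -> a = b.
Proof.
move=> symE irrE /determining_setP dS aS bS ab.
suff /permP/(_ a) : tperm a b = 1%g by rewrite tpermL perm1.
apply: dS => [u v|x xS]; last first.
  by case: tpermP xS => // ->; rewrite ?(negPf aS) ?(negPf bS).
case: (tpermP a b u) => [->|->|/eqP ua /eqP ub];
  case: (tpermP a b v) => [->|->|/eqP va /eqP vb] //; rewrite ?irrE //.
- by rewrite ab.
- by rewrite ab.
- by rewrite symE -ab // symE.
- by rewrite symE ab // symE.
Qed.

Lemma determining_number_complete :
  (0 < #|T|)%N -> (forall u v, e u v = (u != v)) ->
  determining_number e = #|T|.-1.
Proof.
move=> T_gt0 eE; apply/eqP; rewrite eqn_leq; apply/andP; split.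
  have /card_gt0P[x _] := T_gt0.
  rewrite -(cardsC1 x); apply: determining_number_le.
  apply/determining_setP => s _ fs; apply/permP => y; rewrite perm1.
  have [->|yx] := eqVneq y x; last by apply: fs; rewrite !inE.
  have [//|sxx] := eqVneq (s x) x.
  by have /perm_inj := fs (s x) ltac:(by rewrite !inE).
have [S dS <-] := determining_numberP.
have := cardsC S; suff : (#|~: S| <= 1)%N by lia.
rewrite leqNgt; apply/negP => /card_gt1P[a [b [+ + /eqP]]]; rewrite !inE.
move=> aS bS; apply; apply: determining_set_twins dS aS bS _.
- by move=> u v; rewrite !eE eq_sym.
- by move=> u; rewrite eE eqxx.
- by move=> w wa wb; rewrite !eE eq_sym wa eq_sym wb.
Qed.

End DeterminingNumber.

(** * Arithmetic in characteristic two *)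

Section Z2.

Lemma Z2_cases (x : 'Z_2) : (x = 0) \/ (x = 1).
Proof. by case: x => [[|[|//]] i]; [left|right]; apply: val_inj. Qed.

Lemma addZ2 (x : 'Z_2) : x + x = 0.
Proof. by case: (Z2_cases x) => ->; apply: val_inj. Qed.

Lemma neqZ2 (x y : 'Z_2) : (x != y) = (y == x + 1).
Proof. by case: (Z2_cases x) => ->; case: (Z2_cases y) => ->. Qed.

Variable k : nat.
Implicit Types u v : 'rV['Z_2]_k.

Lemma addvv u : u + u = 0.
Proof. by apply/rowP => i; rewrite !mxE addZ2. Qed.

Lemma oppv u : - u = u.
Proof. by apply/eqP; rewrite eq_sym -addr_eq0 addvv. Qed.

Lemma addvK v : involutive (fun u => u + v).
Proof. by move=> u; rewrite -addrA addvv addr0. Qed.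

Lemma card_Z2row : #|{: 'rV['Z_2]_k}| = (2 ^ k)%N.
Proof. by rewrite card_mx mul1n card_ord. Qed.

End Z2.

(** * Subsets of Z_2^k without translation symmetry *)

Section Rigid.

Variable k : nat.
Local Notation W := 'rV['Z_2]_k.

Definition rigid_set (F : {set W}) :=
  forall c, (forall x, x \in F -> x + c \in F) -> c = 0.

(** Concluding [s = 1] rather than [c = 0] builds in injectivity: two points with equal images could
    be transposed with [c = 0]. *)
Definition rigid (I : finType) (f : I -> W) :=
  forall (s : {perm I}) c, (forall i, f (s i) = f i + c) -> s = 1%g.

Lemma rigid_inj (I : finType) (f : I -> W) : rigid f -> injective f.
Proof.
move=> rf a b fab.
suff /permP/(_ a) : tperm a b = 1%g by rewrite tpermL perm1.
by apply: (rf _ 0) => i; rewrite addr0; case: tpermP => // ->.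
Qed.

(** A translation preserving the image lifts through the injection [f] to a permutation of [I],
    which rigidity makes trivial. *)
Lemma rigid_codom (I : finType) (f : I -> W) :
  (0 < #|I|)%N -> rigid f -> rigid_set [set f i | i in I].
Proof.
move=> /card_gt0P[i0 _] rf c Fc; have f_inj := rigid_inj rf.
have ex i : exists j, f j == f i + c.
  have /imsetP[j _ ->] : f i + c \in [set f i | i in I].
    by apply/Fc/imset_f.
  by exists j.
pose s i := xchoose (ex i).
have sE i : f (s i) = f i + c by apply/eqP; exact: (xchooseP (ex i)).
have s_inj : injective s.
  by move=> i j sij; apply: f_inj; apply: (addIr c); rewrite -!sE sij.
have := rf (perm s_inj) c (fun i => etrans (congr1 f (permE s_inj i)) (sE i)).
move=> /permP/(_ i0); rewrite permE perm1 => si0.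
by have := sE i0; rewrite si0 -{1}[f i0]addr0 => /addrI.
Qed.

Lemma rigid_enum (F : {set W}) (N : nat) :
  rigid_set F -> #|F| = N -> exists f : 'I_N -> W, rigid f.
Proof.
move=> rF cF; case: N / cF; exists (@enum_val _ (mem F)) => s c sc.
have c0 : c = 0.
  apply: rF => x xF; rewrite -(enum_rankK_in xF xF) -sc; exact: enum_valP.
by apply/permP => i; rewrite perm1; apply: enum_val_inj; rewrite sc c0 addr0.
Qed.

(* Summing the elements of F over a translate of F by c gives #|F| * c = 0. *)
Lemma odd_rigid (F : {set W}) : odd #|F| -> rigid_set F.
Proof.
move=> oF c Fc.
have : \sum_(x in F) x = \sum_(x in F) (x + c).
  rewrite (reindex_inj (inv_inj (addvK c))); apply: eq_bigl => x.
  by apply/idP/idP => /Fc //; rewrite addvK.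
rewrite big_split /= -{1}[\sum_(x in F) x]addr0 => /addrI.
rewrite sumr_const -(odd_double_half #|F|) oF -muln2 mulrnDr mulrnA mulr2n.
by rewrite addvv addr0 mulr1n.
Qed.

(** Translation by [p + q] swaps [p] and [q], so it preserves the complement of the pair. *)
Lemma rigid_setN2 (p q : W) (F : {set W}) :
  p != q -> rigid_set F -> ~: F != [set p; q].
Proof.
move=> pq rF; apply/eqP => FE.
have inF x : (x \notin F) = (x == p) || (x == q) by rewrite -in_setC FE !inE.
have pq0 : p + q = 0.
  apply: rF => x; apply: contraLR; rewrite !inF.
  case/orP => /eqP/(canRL (addvK _)) ->; first by rewrite addrA addvv add0r eqxx orbT.
  by rewrite [p + q]addrC addrA addvv add0r eqxx.
by move/eqP: pq0; rewrite addr_eq0 oppv (negPf pq).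
Qed.

Lemma rigid_card (F : {set W}) :
  (4 < #|F|)%N -> rigid_set F -> odd #|F| || (#|F| + 4 <= 2 ^ k)%N.
Proof.
move=> F_gt4 rF; case: (boolP (odd _)) => //= eF.
have cW := cardsC F; rewrite card_Z2row in cW.
have e2k : ~~ odd (2 ^ k).
  have : (4 < 2 ^ k)%N by lia.
  by rewrite oddX orbF; move: {F F_gt4 rF eF cW}k => [|j].
have : ~~ odd #|~: F| by rewrite -cW oddD (negPf eF) in e2k.
case cC: #|~: F| => [|[|[|[|m]]]] // _; last by rewrite -cW cC leq_add2l.
  (* If the complement is empty, every translation preserves [F], in particular the one by the
     difference of two distinct elements. *)
  have := card_gt1P (leq_trans _ F_gt4) => /(_ isT) [p [q [_ _ /eqP[]]]].
  apply/eqP; rewrite -subr_eq0 oppv; apply/eqP; apply: rF => x _.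
  by rewrite -[F]setCK (cards0_eq cC) setC0 inE.
have /eqP/cards2P[p [q [pq FE]]] := cC.
by have := rigid_setN2 pq rF; rewrite FE eqxx.
Qed.

Lemma subset_card (T : finType) (A : {set T}) a :
  (a <= #|A|)%N -> exists2 B : {set T}, B \subset A & #|B| = a.
Proof.
case/card_geqP => s [us ss sA]; exists [set x in s].
  by apply/subsetP => x; rewrite inE; apply: sA.
by rewrite cardsE; move/card_uniqP: us => ->.
Qed.

(* A translation c off the hyperplane H would swap F inside and outside H, which
   have different sizes; on H, odd cardinality forces c = 0. *)
Lemma split_rigid (p : W -> 'Z_2) (F : {set W}) :
  {morph p : x y / x + y} ->
  odd #|[set x in F | p x == 0]| ->
  #|[set x in F | p x == 0]| != #|[set x in F | p x != 0]| ->
  rigid_set F.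
Proof.
set A := [set x in F | _ == 0]; set B := [set x in F | _ != 0] => pD oA AB c Fc.
have FcE x : (x + c \in F) = (x \in F).
  by apply/idP/idP => /Fc //; rewrite addvK.
have [pc|pc] := Z2_cases (p c).
  by apply: (odd_rigid oA) => x; rewrite !inE FcE pD pc addr0.
case/eqP: AB; rewrite -(card_imset _ (inv_inj (addvK c))); apply: eq_card => x.
rewrite (can_imset_pre _ (addvK c)) !inE FcE pD pc.
by case: (Z2_cases (p x)) => ->.
Qed.

End Rigid.

Lemma rigid_exists (k N : nat) :
  (4 < N <= 2 ^ k)%N -> odd N || (N + 4 <= 2 ^ k)%N ->
  exists f : 'I_N -> 'rV['Z_2]_k, rigid f.
Proof.
move=> /andP[N_gt4 N_le]; have [oN _|/= eN N4] := boolP (odd N).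
  have [|F _ cF] := @subset_card _ [set: 'rV['Z_2]_k] N.
    by rewrite cardsT card_Z2row.
  by apply: (rigid_enum (odd_rigid _) cF); rewrite cF.
case: k N4 {N_le} => [|k] N4; first by lia.
pose p (x : 'rV['Z_2]_k.+1) := x 0 0.
pose H := [set x | p x == 0].
(* Translation by the all-ones vector swaps [H] and its complement. *)
have cH : #|H| = #|~: H|.
  rewrite -(card_imset _ (inv_inj (addvK (const_mx 1)))).
  apply: eq_card => x; rewrite (can_imset_pre _ (addvK _)) !inE /p !mxE.
  by case: (Z2_cases (x 0 0)) => ->.
have cHC : #|H| = (2 ^ k)%N.
  by have := cardsC H; rewrite -cH card_Z2row expnS; lia.
(* Either the parts have sizes N - 1 and 1, or the first fills all but one point of [H], and N + 4
   <= 2^(k+1) leaves at most 2^k - 3 for the second. Both sizes are odd and they differ. *)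
pose a := if (N <= 2 ^ k)%N then N.-1 else (2 ^ k).-1.
have k_gt0 : (2 ^ k = 2 * 2 ^ k.-1)%N.
  by case: (k) N4 => [|j] N4; [lia | rewrite -expnS].
rewrite expnS in N4.
have oa : odd a by rewrite /a; case: ifP => _; lia.
have aN : a != (N - a)%N by rewrite /a; case: ifP; lia.
have [|A sA cA] := @subset_card _ H a; first by rewrite /a; case: ifP; lia.
have [|B sB cB] := @subset_card _ (~: H) (N - a).
  by rewrite -cH /a; case: ifP; lia.
have AE : [set x in A :|: B | p x == 0] = A.
  apply/setP => x; rewrite !inE /=; have := subsetP sA x; have := subsetP sB x.
  by rewrite !inE; case: (x \in A) => [_ ->|/=] //; case: (x \in B) => // /(_ isT)/negPf->.
have BE : [set x in A :|: B | p x != 0] = B.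
  apply/setP => x; rewrite !inE /=; have := subsetP sA x; have := subsetP sB x.
  rewrite !inE; case: (x \in B) => [->|_] //; rewrite ?orbT //.
  by case: (x \in A) => // /(_ isT) ->.
apply: (@rigid_enum _ (A :|: B)).
  apply: (@split_rigid _ p); rewrite ?AE ?BE ?cA ?cB //.
  by move=> x y; rewrite /p !mxE.
rewrite cardsU (_ : A :&: B = set0) ?cards0.
  by rewrite cA cB /a; case: ifP; lia.
apply/eqP; rewrite setI_eq0 disjoints_subset (subset_trans sA) //.
by rewrite -(setCK H) setCS.
Qed.

(** * The folded hypercube as a Cayley graph *)

Section FoldedHypercube.

Variable n : nat.
Local Notation V := 'rV['Z_2]_n.
Local Notation I := 'I_n.+1.
Implicit Types (u v : V) (f : I -> 'Z_2) (i j : I) (s : {perm I}).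

(* 'Z_2^n is identified with the functions on n + 1 points modulo constants:
   [ext] is the representative vanishing at [ord_max], [red] the projection. *)
Definition ext u i : 'Z_2 :=
  if unlift ord_max i is Some j then u 0 j else 0.

Definition red f : V := \row_j (f (lift ord_max j) - f ord_max).

(** The n + 1 generators: unit vectors, and the all-ones vector at [ord_max]. *)
Definition dir i : V := red (fun j => (j == i)%:R).

(** The linear action of the symmetric group on n + 1 points. It is more than coordinate
    permutation, since [s] may move [ord_max]. As [s] acts by precomposition, directions are
    permuted by the inverse of [s]. *)
Definition permV s u : V := red (fun i => ext u (s i)).

Lemma ext_max u : ext u ord_max = 0.
Proof. by rewrite /ext unlift_none. Qed.

Lemma ext_lift u (j : 'I_n) : ext u (lift ord_max j) = u 0 j.
Proof. by rewrite /ext liftK. Qed.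

Lemma extD u v i : ext (u + v) i = ext u i + ext v i.
Proof. by rewrite /ext; case: unlift => [j|]; rewrite ?mxE ?addr0. Qed.

Lemma ext_red f i : ext (red f) i = f i - f ord_max.
Proof.
by case: (unliftP ord_max i) => [j|] ->; rewrite ?ext_lift ?mxE // ext_max subrr.
Qed.

Lemma extK u : red (ext u) = u.
Proof. by apply/rowP => j; rewrite mxE ext_lift ext_max subr0. Qed.

Lemma eq_red f f' : f =1 f' -> red f = red f'.
Proof. by move=> ff; apply/rowP => j; rewrite !mxE !ff. Qed.

Lemma red_const f f' c : (forall i, f i = f' i + c) -> red f = red f'.
Proof. by move=> ff; apply/rowP => j; rewrite !mxE !ff; ring. Qed.

Lemma redD f f' : red (fun i => f i + f' i) = red f + red f'.
Proof. by apply/rowP => j; rewrite !mxE; ring. Qed.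

Lemma permVD s u v : permV s (u + v) = permV s u + permV s v.
Proof. by rewrite -redD; apply: eq_red => i; rewrite extD. Qed.

Lemma permV_red s f : permV s (red f) = red (fun i => f (s i)).
Proof. by apply: (@red_const _ _ (- f ord_max)) => i; rewrite ext_red. Qed.

Lemma permV_dir s i : permV s (dir (s i)) = dir i.
Proof. by rewrite permV_red; apply: eq_red => j; rewrite (inj_eq perm_inj). Qed.

Lemma permVK s : cancel (permV s) (permV s^-1).
Proof.
move=> u; rewrite permV_red -[RHS]extK; apply: eq_red => i.
by rewrite permKV.
Qed.

Lemma dir_lift (j : 'I_n) : dir (lift ord_max j) = delta_mx 0 j.
Proof.
apply/rowP => l; rewrite !mxE (inj_eq lift_inj) (negPf (neq_lift _ _)) subr0.
by rewrite andTb.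
Qed.

Lemma dir_max : dir ord_max = const_mx 1.
Proof.
apply/rowP => l; rewrite !mxE eqxx eq_sym (negPf (neq_lift _ _)).
exact: val_inj.
Qed.

Lemma dir_ind (P : V -> Prop) :
  P 0 -> (forall u i, P u -> P (u + dir i)) -> forall u, P u.
Proof.
move=> P0 PD u; rewrite [u]row_sum_delta.
elim/big_rec: _ => // j v _ Pv; rewrite addrC.
case: (Z2_cases (u 0 j)) => ->; rewrite ?scale0r ?addr0 // scale1r -dir_lift.
exact: PD.
Qed.

Lemma folded_hypercubeE u v :
  (1 < n)%N -> folded_hypercube u v = [exists i, v == u + dir i].
Proof.
move=> n_gt1; rewrite /folded_hypercube /hamming.
set D := [set i | _]; apply/orP/existsP => [[/cards1P[j Dj]|Dn]|[i /eqP vE]].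
- exists (lift ord_max j); apply/eqP/rowP => l; rewrite dir_lift !mxE /=.
  have : (l \in D) = (l == j) by rewrite Dj inE.
  rewrite inE; case: (l == j); first by rewrite neqZ2 => /eqP.
  by move/negbFE/eqP => ->; rewrite addr0.
- exists ord_max; apply/eqP/rowP => l; rewrite dir_max !mxE.
  have : l \in D.
    suff -> : D = setT by [].
    by apply/eqP; rewrite eqEcard subsetT cardsT card_ord (eqP Dn) leqnn.
  by rewrite inE neqZ2 => /eqP.
case: (unliftP ord_max i) vE => [j|] -> vE.
  left; apply/cards1P; exists j; apply/setP => l.
  rewrite !inE vE dir_lift neqZ2 !mxE /= (inj_eq (addrI _)).
  by case: (l == j).
right; suff -> : D = setT by rewrite cardsT card_ord.
by apply/setP => l; rewrite !inE vE dir_max neqZ2 !mxE eqxx.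
Qed.

Lemma folded_hypercube_dir u i : (1 < n)%N -> folded_hypercube u (u + dir i).
Proof. by move=> n_gt1; rewrite folded_hypercubeE //; apply/existsP; exists i. Qed.

(** * Four-cycles and automorphisms *)

Lemma card_gt_avoid (T : finType) (A : seq T) :
  (size A < #|T|)%N -> exists x, x \notin A.
Proof.
move=> sA; apply/existsP; rewrite -negb_forall; apply: contraL sA.
move=> /forallP AT; rewrite -leqNgt; apply: leq_trans (card_size A).
by apply/subset_leq_card/subsetP => x _; apply: AT.
Qed.

Lemma red_eq0 f : red f = 0 -> forall i, f i = f ord_max.
Proof.
move=> rf i; apply/eqP; rewrite -subr_eq0 -ext_red rf /ext.
by case: unlift => // j; rewrite mxE.
Qed.

Lemma dir_inj : (1 < n)%N -> injective dir.
Proof.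
move=> n_gt1 i j /eqP; rewrite -subr_eq0 oppv -redD => /eqP/red_eq0 ij.
have [|l] := @card_gt_avoid _ [:: i; j]; first by rewrite card_ord.
rewrite !inE negb_or => /andP[/negPf li /negPf lj].
have := ij i; rewrite -(ij l) li lj eqxx.
by case: eqVneq.
Qed.

(** The sum of the four indicators is constant, and vanishes at a fifth point, which exists since n
    + 1 >= 5. Evaluation at [i] then forces [l = i], and evaluation at [k] forces [k = j]. *)
Lemma dir_add_eq i j k l : (3 < n)%N -> i != j -> i != k ->
  dir i + dir k = dir j + dir l -> k = j.
Proof.
move=> n_gt3 /negPf ij /negPf ik /eqP; rewrite -subr_eq0 oppv -!redD.
move=> /eqP/red_eq0 h.
have [|m] := @card_gt_avoid _ [:: i; j; k; l]; first by rewrite card_ord.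
rewrite !inE !negb_or => /and4P[/negPf mi /negPf mj /negPf mk /negPf ml].
have {}h x : ((x == i)%:R + (x == k)%:R + ((x == j)%:R + (x == l)%:R) = 0 :> 'Z_2).
  by rewrite h -(h m) mi mj mk ml !addr0.
have := h i; rewrite eqxx ij ik.
have [il|] := eqVneq i l; last by move=> _ /(congr1 val).
move=> _; have := h k; rewrite eqxx [k == i]eq_sym ik -il [k == i]eq_sym ik.
by case: eqVneq => // _ /(congr1 val).
Qed.

(** At each vertex [u], [phi] permutes the directions by some [t u]. The images of four-cycles show
    that [t u] does not depend on [u], so [phi] is affine. *)
Lemma automorphism_permV (phi : {perm V}) : (3 < n)%N ->
  (forall u v, folded_hypercube (phi u) (phi v) = folded_hypercube u v) ->
  exists s, forall u, phi u = phi 0 + permV s u.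
Proof.
move=> n_gt3 aphi; have n_gt1 : (1 < n)%N by lia.
have ex u i : exists j, phi (u + dir i) == phi u + dir j.
  by apply/existsP; rewrite -folded_hypercubeE // aphi folded_hypercube_dir.
pose t u i := xchoose (ex u i).
have tE u i : phi (u + dir i) = phi u + dir (t u i).
  by apply/eqP; exact: (xchooseP (ex u i)).
have t_inj u : injective (t u).
  move=> i j tij; apply: (dir_inj n_gt1); apply: (addrI u).
  by apply: (@perm_inj _ phi); rewrite !tE tij.
have tD u i j : t (u + dir i) j = t u j.
  have [->|ij] := eqVneq j i.
    apply: (dir_inj n_gt1); apply: (addrI (phi (u + dir i))).
    by rewrite -tE addvK tE addvK.
  have h : dir (t u i) + dir (t (u + dir i) j) = dir (t u j) + dir (t (u + dir j) i).
    by apply: (addrI (phi u)); rewrite !addrA -!tE addrAC.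
  apply: dir_add_eq n_gt3 _ _ h; first by rewrite (inj_eq (@t_inj u)) eq_sym.
  (* Equal directions would bring the image path back to [phi u] after two steps, so [dir i + dir j]
     would be 0. *)
  apply: contraNneq ij => ti; have := tE (u + dir i) j.
  rewrite -ti [phi (u + dir i)]tE addvK => /perm_inj/esym/eqP.
  rewrite -{1}[u]addr0 -addrA (inj_eq (addrI _)) eq_sym addr_eq0 oppv.
  by move=> /eqP/(dir_inj n_gt1) ->.
pose s := perm (@t_inj 0).
have tE0 u : t u =1 t 0.
  by elim/dir_ind: u => // u i IH j; rewrite tD IH.
exists s^-1%g; elim/dir_ind => [|u i IH].
  rewrite (_ : permV _ 0 = 0) ?addr0 //; apply: (addrI (permV s^-1 0)).
  by rewrite -permVD !addr0.
rewrite permVD addrA -IH tE tE0; congr (_ + _).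
by rewrite -[t 0 i](permE (@t_inj 0)) -(permV_dir s^-1) permK.
Qed.

(** Conjugating by a translation moves the fixed vertex from 0 to [x]. *)
Lemma permV_automorphism x s : (1 < n)%N ->
  exists2 phi : {perm V}, (forall u, phi u = x + permV s (u - x)) &
    (forall u v, folded_hypercube (phi u) (phi v) = folded_hypercube u v).
Proof.
move=> n_gt1; pose g u := x + permV s (u - x).
have g_inj : injective g.
  by move=> u v /addrI/(can_inj (permVK s))/addIr.
exists (perm g_inj) => [u|u v]; first by rewrite permE.
have gD w i : g (w + dir (s i)) = g w + dir i.
  by rewrite /g [w + _ - x]addrAC (permVD _ (w - x)) permV_dir addrA.
rewrite !permE !folded_hypercubeE //; apply/existsP/existsP => -[i /eqP vE].
  by exists (s i); apply/eqP/g_inj; rewrite gD.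
by exists (s^-1%g i); rewrite vE -{1}[i](permKV s) gD.
Qed.

(** * From determining sets to rigid maps *)

Section Family.

Variable k : nat.

(** The transpose of the family: [k] functions on n + 1 points become one map from the points to
    Z_2^k. *)
Definition coordf (w : 'I_k -> V) i : 'rV['Z_2]_k := \row_j ext (w j) i.

(** An automorphism fixing 0 is some [permV s]. It fixes [w j] iff precomposition with [s] changes
    [ext (w j)] by a constant, and these constants are the coordinates of a translation. *)
Lemma determining_rigid (w : 'I_k -> V) : (3 < n)%N -> rigid (coordf w) ->
  determining_set (@folded_hypercube n) (0 |: [set w j | j : 'I_k]).
Proof.
move=> n_gt3 rw; apply/determining_setP => phi aphi fphi.
have [s sE] := automorphism_permV n_gt3 aphi.
have phi0 : phi 0 = 0 by apply: fphi; rewrite !inE eqxx.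
have s1 : s = 1%g.
  pose c : 'rV['Z_2]_k := \row_j ext (w j) (s ord_max).
  apply: (rw s c) => i; apply/rowP => j; rewrite !mxE.
  have wj : permV s (w j) = w j.
    rewrite -[LHS]add0r -phi0 -sE; apply: fphi.
    by rewrite !inE; apply/orP; right; apply: imset_f.
  by rewrite -{2}wj ext_red subrK.
apply/permP => u; rewrite perm1 sE phi0 add0r s1 -[RHS]extK.
by apply: eq_red => i; rewrite perm1.
Qed.

(** A permutation that translates [coordf w] induces an automorphism fixing [x] and every [x + w j].
    It is trivial, and so is [s] because distinct points give distinct directions. *)
Lemma rigid_determining (x : V) (w : 'I_k -> V) : (1 < n)%N ->
  determining_set (@folded_hypercube n) (x |: [set x + w j | j : 'I_k]) ->
  rigid (coordf w).
Proof.
move=> n_gt1 /determining_setP dS s c sc.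
have [phi phiE aphi] := permV_automorphism x s n_gt1.
have phi1 : phi = 1%g.
  apply: dS => // u; rewrite !inE => /orP[/eqP ->|/imsetP[j _ ->]]; rewrite phiE.
    rewrite subrr -[RHS]addr0; congr (_ + _); apply/rowP => j.
    by rewrite !mxE /ext; do 2!case: unlift => [?|]; rewrite ?mxE ?subrr.
  rewrite [x + w j - x]addrC addKr -{2}[w j]extK; congr (_ + _).
  apply: (@red_const _ _ (c 0 j)) => i.
  by have /rowP/(_ j) := sc i; rewrite !mxE.
apply/permP => i; rewrite perm1; apply: (dir_inj n_gt1).
have := phiE (x + dir (s i)); rewrite phi1 perm1 [x + dir _]addrC addrK permV_dir.
by rewrite addrC => /addrI.
Qed.

End Family.

Lemma folded_hypercube_det_le k : (3 < n)%N -> (n < 2 ^ k)%N ->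
  odd n.+1 || (n.+1 + 4 <= 2 ^ k)%N ->
  (determining_number (@folded_hypercube n) <= k.+1)%N.
Proof.
move=> n_gt3 nk hk; have [|f rf] := @rigid_exists k n.+1 _ hk; first by lia.
(* [coordf w] is [f] translated to vanish at [ord_max], which preserves rigidity. *)
pose w (j : 'I_k) := red (fun i => f i 0 j).
have rw : rigid (coordf w).
  move=> s c sc; apply: (rf s c) => i; apply/rowP => j.
  have /rowP/(_ j) := sc i; rewrite !mxE !ext_red => h.
  by rewrite -[LHS](subrK (f ord_max 0 j)) h; ring.
apply: leq_trans (determining_number_le (determining_rigid n_gt3 rw)) _.
rewrite cardsU1; apply: (@leq_add _ _ 1); first by case: (_ \notin _).
by apply: leq_trans (leq_imset_card _ _) _; rewrite card_ord.
Qed.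

Lemma folded_hypercube_det_ge k : (3 < n)%N ->
  (determining_number (@folded_hypercube n) <= k.+1)%N ->
  (n < 2 ^ k)%N /\ (odd n.+1 || (n.+1 + 4 <= 2 ^ k)%N).
Proof.
move=> n_gt3; have [S dS <-] := determining_numberP (@folded_hypercube n).
move=> Sk.
have [x [cS {}dS]] : exists x : V, (#|S :\ x| <= k)%N /\
    determining_set (@folded_hypercube n) (x |: S :\ x).
  have [S0|[x xS]] := set_0Vmem S.
    exists 0; rewrite S0 set0D cards0; split => //.
    by apply: determining_setS dS; rewrite S0 sub0set.
  by exists x; rewrite setD1K //; move: Sk; rewrite (cardsD1 x) xS.
(* The default [x] pads the family with zero vectors when [S :\ x] has fewer than [k] elements. *)
pose w (j : 'I_k) := nth x (enum (S :\ x)) j - x.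
have rw : rigid (coordf w).
  apply: (@rigid_determining _ x); first by lia.
  apply: determining_setS dS; apply: setUS; apply/subsetP => y yS.
  have yi : (index y (enum (S :\ x)) < k)%N.
    by apply: leq_trans cS; rewrite cardE index_mem mem_enum.
  apply/imsetP; exists (Ordinal yi) => //.
  by rewrite /w /= nth_index ?mem_enum // addrC subrK.
have cF : #|[set coordf w i | i in I]| = n.+1.
  by rewrite card_imset ?card_ord //; apply: rigid_inj.
have rF : rigid_set [set coordf w i | i in I].
  by apply: rigid_codom rw; rewrite card_ord.
split; first by rewrite -cF -card_Z2row max_card.
by rewrite -cF; apply: rigid_card; rewrite // cF.
Qed.

End FoldedHypercube.

(** * The cases n <= 3 *)

Lemma folded_hypercube_det1 : determining_number (@folded_hypercube 1) = 1%N.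
Proof.
rewrite determining_number_complete ?card_Z2row // => u v.
rewrite /folded_hypercube orbb /hamming; apply/cards1P/idP => [[i /setP/(_ i)]|uv].
  by rewrite !inE eqxx => h; apply/eqP => uv; rewrite uv eqxx in h.
exists 0; apply/setP => i; rewrite [i]ord1 !inE eqxx.
apply: contraNneq uv => uv; apply/eqP/rowP => j.
by rewrite [j]ord1.
Qed.

Lemma folded_hypercube_det2 : determining_number (@folded_hypercube 2) = 3%N.
Proof.
rewrite determining_number_complete ?card_Z2row // => u v.
rewrite /folded_hypercube; set h := hamming u v.
have : (h <= 2)%N by rewrite -[X in (_ <= X)%N](card_ord 2) max_card.
suff -> : (u != v) = (0 < h)%N by case: h => [|[|[|]]].
apply/idP/card_gt0P => [uv|[i]]; last first.
  by rewrite inE; apply: contraNneq => ->.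
by have /rV0Pn[i] : u - v != 0; rewrite ?subr_eq0 // !mxE subr_eq0 => ?; exists i; rewrite inE.
Qed.

(** The distances 1 and 3 are exactly the odd ones here, and the coordinate sum modulo 2 detects
    parity. *)
Lemma folded_hypercube3E (u v : 'rV['Z_2]_3) :
  folded_hypercube u v = (\sum_i u 0 i != \sum_i v 0 i).
Proof.
rewrite /folded_hypercube /hamming -sum1dep_card big_mkcond /=.
rewrite !big_ord_recl !big_ord0.
move: (u 0 _) (u 0 _) (u 0 _) (v 0 _) (v 0 _) (v 0 _) => a b c a' b' c'.
case: (Z2_cases a) => ->; case: (Z2_cases b) => ->; case: (Z2_cases c) => ->;
case: (Z2_cases a') => ->; case: (Z2_cases b') => ->; case: (Z2_cases c') => -> //.
Qed.

(* FQ_3 is K_{4,4}, with vertices of the same parity as twins. *)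
Lemma folded_hypercube_det3 : determining_number (@folded_hypercube 3) = 6%N.
Proof.
apply/eqP; rewrite eqn_leq; apply/andP; split.
  pose x : 'rV['Z_2]_3 := delta_mx 0 0.
  have px : \sum_i x 0 i = 1.
    by rewrite !big_ord_recl big_ord0 !mxE; apply: val_inj.
  have p0 : \sum_i (0 : 'rV['Z_2]_3) 0 i = 0 by rewrite big1 // => i; rewrite mxE.
  have x0 : 0 != x.
    by apply/eqP => /(congr1 (fun y : 'rV['Z_2]_3 => y 0 0)); rewrite !mxE.
  have <- : #|~: [set 0; x]| = 6%N.
    by have := cardsC [set 0; x]; rewrite cards2 x0 card_Z2row; lia.
  apply: determining_number_le; apply/determining_setP => s es fs.
  have [y yS] : exists y, y \in ~: [set 0; x].
    exists (const_mx 1); rewrite !inE negb_or; apply/andP; split; apply/eqP => /rowP.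
      by move/(_ 0); rewrite !mxE.
    by move/(_ (lift 0 0)); rewrite !mxE.
  (* The fixed vertex [y] keeps [s] from swapping the two parity classes. The omitted vertices 0 and
     [x] have different parities, so each is fixed. *)
  have ps u : (\sum_i (s u) 0 i == \sum_i u 0 i).
    have := es u y; rewrite (fs _ yS) !folded_hypercube3E.
    move: (\sum_i _) (\sum_i _) (\sum_i _) => a b c.
    by case: (Z2_cases a) => ->; case: (Z2_cases b) => ->; case: (Z2_cases c) => ->.
  have sx u : u \in [set 0; x] -> s u \in [set 0; x].
    by apply: contraLR; rewrite -!in_setC => suS; have /perm_inj <- := fs _ suS.
  apply/permP => u; rewrite perm1.
  have [uS|] := boolP (u \in [set 0; x]); last by rewrite -in_setC => /fs.
  have := sx _ uS; have := ps u; move: uS; rewrite !inE.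
  by case/orP => /eqP ->; move=> pu /orP[] /eqP sE; move: pu; rewrite sE ?p0 ?px.
have [S dS <-] := determining_numberP (@folded_hypercube 3).
have := cardsC S; rewrite card_Z2row; suff : (#|~: S| <= 2)%N by lia.
rewrite leqNgt; apply/negP => /card_gt2P[a [b [c [[aS bS cS] [ab bc ca]]]]].
have twins u v : u \in ~: S -> v \in ~: S -> \sum_i u 0 i = \sum_i v 0 i -> u = v.
  rewrite !inE => uS vS puv; apply: determining_set_twins dS uS vS _.
  - exact: folded_hypercube_sym.
  - exact: folded_hypercube_irr.
  - by move=> w _ _; rewrite !folded_hypercube3E puv.
(* Among three vertices, two have the same parity. *)
have [pab|pab] := eqVneq (\sum_i a 0 i) (\sum_i b 0 i).
  by rewrite (twins a b) ?eqxx in ab.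
have [pbc|pbc] := eqVneq (\sum_i b 0 i) (\sum_i c 0 i).
  by rewrite (twins b c) ?eqxx in bc.
rewrite (twins c a) ?eqxx // in ca.
by move: pab pbc; rewrite !neqZ2 => /eqP -> /eqP ->; rewrite -addrA addZ2 addr0.
Qed.

Local Close Scope ring_scope.

(* up_log 2 n, the least e with n <= 2 ^ e, is the ceiling of lg n for n >= 1. *)
Theorem theorem5p6 (n : nat) (n_gt0 : 0 < n) :
  let det := determining_number (@folded_hypercube n) in
  let special := exists m : nat, 3 <= m /\ (n = 2 ^ m - 1 \/ n = 2 ^ m - 3) in
  (n = 1 -> det = 1) /\
  (n = 2 -> det = 3) /\
  (n = 3 -> det = 6) /\
  (special -> det = up_log 2 n + 2) /\
  (n <> 1 -> n <> 2 -> n <> 3 -> ~ special -> det = up_log 2 n.+1 + 1).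
Proof.
move=> det special; split; first by move=> n1; rewrite /det n1 folded_hypercube_det1.
split; first by move=> n2; rewrite /det n2 folded_hypercube_det2.
split; first by move=> n3; rewrite /det n3 folded_hypercube_det3.
split.
  (* After the shift of [m], n + 1 is 2^(m+1) or 2^(m+1) - 2: the even sizes that fit in dimension m
     + 1 without leaving four points over. Dimension m + 2 is thus needed, and the base vertex adds
     one. *)
  case=> m [m_ge3 nE]; have {m m_ge3 nE}[m [m_gt1 nE]] : exists m, 1 < m /\
      (n = 2 ^ m.+1 - 1 \/ n = 2 ^ m.+1 - 3).
    by exists m.-1; rewrite prednK; [split=> //; lia | lia].
  have m4 : 4 <= 2 ^ m by rewrite (@leq_exp2l 2 2).
  have nm : up_log 2 n = m.+1 by apply: up_log_eq; rewrite // expnS in nE *; lia.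
  have n_gt3 : 3 < n by rewrite expnS in nE; lia.
  rewrite nm addn2; apply/eqP; rewrite eqn_leq folded_hypercube_det_le //; last first.
  - by rewrite !expnS in nE *; lia.
  - by rewrite !expnS in nE *; lia.
  rewrite ltnNge; apply/negP => /(folded_hypercube_det_ge n_gt3) [_].
  by rewrite !expnS in nE *; lia.
move=> n1 n2 n3 nsp; have n_gt3 : 3 < n by lia.
have := @up_log_bounds 2 n.+1 isT n_gt0.
case kE : (up_log 2 n.+1) => [|k] /= /andP[kn nk]; first by lia.
have k_gt1 : 1 < k.
  by rewrite ltnNge; apply/negP => k1; have := @leq_pexp2l 2 _ _ isT k1; rewrite expnS in nk; lia.
rewrite addn1; apply/eqP; rewrite eqn_leq folded_hypercube_det_le //=; last first.
  (* For odd n, if fewer than four points are left over then n + 1 is 2^(k+1) or 2^(k+1) - 2, which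
     makes n special. *)
  case: (boolP (odd n)) => //= on; rewrite leqNgt; apply/negP => n4; apply: nsp.
  exists k.+1; split=> //; rewrite expnS in nk n4 *; lia.
rewrite ltnNge; apply/negP => /(folded_hypercube_det_ge n_gt3) [nk' _].
by lia.
Qed.
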